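(* Let $\mathcal{I}(\mathcal{D},\mathcal{P},\mathcal{A})$ be any two-sender unicast index coding problem with an eavesdropper (with any type of interactions between its sub-digraphs). Let $\mathcal{P}_{\{1,2\}}$ be partitioned into two disjoint sets $\mathcal{P}_{\{1,2\}}^{(1)}$ and $\mathcal{P}_{\{1,2\}}^{(2)}$. For $i\in\{1,2\}$ put $\tilde{\mathcal{P}}_i=\mathcal{P}_{\{1,2\}}^{(i)}\cup\mathcal{P}_i$, let $\tilde{\mathcal{D}}_i$ be the sub-digraph of $\mathcal{D}$ induced by the message set $\tilde{\mathcal{P}}_i$, and let $\tilde{\mathcal{A}}_i\subseteq\mathcal{A}$ be the set of indices of the messages in $x_{\mathcal{A}}\cap\tilde{\mathcal{P}}_i$. If for each $i\in\{1,2\}$ there exists a weakly secure linear index code $\tilde{\mathcal{C}}_i$ for the single-sender problem $\mathcal{I}(\tilde{\mathcal{D}}_i,\tilde{\mathcal{A}}_i)$, then the code $\mathcal{C}=(\tilde{\mathcal{C}}_1,\tilde{\mathcal{C}}_2)$, in which sender $\mathcal{S}_i$ transmits $\tilde{\mathcal{C}}_i$ for $i\in\{1,2\}$, is a weakly secure linear index code for the two-sender problem $\mathcal{I}(\mathcal{D},\mathcal{P},\mathcal{A})$.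
   Context: Fix a finite field $\mathbb{F}_q$ and messages $\mathcal{M}=\{x_1,\dots,x_m\}$, $x_i\in\mathbb{F}_q$; $x_i$ is a realization of a random variable $X_i$, and the $X_i$ are independent and uniform on $\mathbb{F}_q$. There are $m$ receivers; receiver $i$ demands $x_i$ and has side-information $\mathcal{K}_i\subseteq\mathcal{M}\setminus\{x_i\}$. The side-information digraph $\mathcal{D}$ has vertices $v_1,\dots,v_m$ and an edge $(v_i,v_j)$ iff $x_j\in\mathcal{K}_i$. For $\mathcal{B}\subseteq[m]=\{1,\dots,m\}$ put $x_{\mathcal{B}}=\{x_i:i\in\mathcal{B}\}$. The sub-digraph of $\mathcal{D}$ induced by a set of messages $\mathcal{Q}$ is the one induced by $\{v_j:x_j\in\mathcal{Q}\}$; it describes the problem with messages and receivers restricted to $\mathcal{Q}$ (side-information $\mathcal{K}_i\cap\mathcal{Q}$). Single-sender problem $\mathcal{I}(\mathcal{D},\mathcal{A})$: one sender knows all messages and transmits $\mathbf{G}\mathbf{x}$, $\mathbf{G}\in\mathbb{F}_q^{l\times m}$, $\mathbf{x}=(x_1,\dots,x_m)^T$; this is a linear index code of length $l$ if every receiver $i$ can recover $x_i$ from $\mathbf{G}\mathbf{x}$ and $\mathcal{K}_i$. An eavesdropper knows $x_{\mathcal{A}}$ and $\mathbf{G}\mathbf{x}$. The code is weakly secure if $H(X_i\mid\mathbf{G}\mathbf{X},X_{\mathcal{A}})=H(X_i)$ for every message index $i\notin\mathcal{A}$ ($H$ is Shannon entropy). Two-sender problem $\mathcal{I}(\mathcal{D},\mathcal{P},\mathcal{A})$: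 sender $\mathcal{S}_j$ knows $\mathcal{M}_j\subseteq\mathcal{M}$, $j\in\{1,2\}$, with $\mathcal{M}_1\cup\mathcal{M}_2=\mathcal{M}$. Put $\mathcal{P}_1=\mathcal{M}_1\setminus\mathcal{M}_2$, $\mathcal{P}_2=\mathcal{M}_2\setminus\mathcal{M}_1$, $\mathcal{P}_{\{1,2\}}=\mathcal{M}_1\cap\mathcal{M}_2$, $\mathcal{P}=(\mathcal{P}_1,\mathcal{P}_2,\mathcal{P}_{\{1,2\}})$. A linear two-sender index code consists of linear codewords $\mathbf{c}_1,\mathbf{c}_2$ over $\mathbb{F}_q$ of lengths $l_1,l_2$, where $\mathbf{c}_j$ (sent by $\mathcal{S}_j$ over a noiseless broadcast channel) is a linear function of the messages in $\mathcal{M}_j$ only, such that each receiver $i$ can recover $x_i$ from $\mathbf{c}_1,\mathbf{c}_2,\mathcal{K}_i$. Its length is $l_1+l_2$. An eavesdropper knows $x_{\mathcal{A}}$, $\mathcal{A}\subsetneq[m]$, and $\mathbf{c}_1,\mathbf{c}_2$; the code is weakly secure if $H(X_i\mid\mathbf{c}_1,\mathbf{c}_2,X_{\mathcal{A}})=H(X_i)$ for all $i\in[m]\setminus\mathcal{A}$. *)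

(* Defs.v *)
From HB Require Import structures.
From mathcomp Require Import all_boot all_order all_algebra.
From mathcomp Require Import all_classical all_reals all_analysis.

Set Implicit Arguments.
Unset Strict Implicit.
Unset Printing Implicit Defensive.

Import Order.TTheory GRing.Theory Num.Theory.

Local Open Scope classical_set_scope.
Local Open Scope ring_scope.

(* The analogue of the library's [pmf] for values in a finite set. *)
Definition fpmf d (T : measurableType d) (R : realType) (P : probability T R)
    (S : finType) (X : T -> S) (a : S) : R :=
  fine (P (X @^-1` [set a])).

(* Entropies are in nats: the choice of the base only rescales them. Since
   [ln 0 = 0] here, null events contribute 0. *)
Definition entropy d (T : measurableType d) (R : realType)
    (P : probability T R) (S : finType) (X : T -> S) : R :=
  - \sum_(a : S) fpmf P X a * ln (fpmf P X a).

Definition cond_entropy d (T : measurableType d) (R : realType)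
    (P : probability T R) (S S' : finType) (X : T -> S) (Y : T -> S') : R :=
  - \sum_(a : S) \sum_(b : S')
      fpmf P (fun t => (X t, Y t)) (a, b) *
      ln (fpmf P (fun t => (X t, Y t)) (a, b) / fpmf P Y b).

(* Finite sets carry the discrete sigma-algebra. *)
Definition discrete_rv d (T : measurableType d) (S : finType) (X : T -> S) :=
  forall a : S, measurable (X @^-1` [set a]).

Definition uniform_rv d (T : measurableType d) (R : realType)
    (P : probability T R) (S : finType) (X : T -> S) :=
  forall a : S, fpmf P X a = #|S|%:R^-1.

Definition mutually_independent d (T : measurableType d) (R : realType)
    (P : probability T R) (I S : finType) (X : I -> T -> S) :=
  forall (J : {set I}) (B : I -> set S),
    fine (P (\bigcap_(i in [set` J]) (X i @^-1` B i))) =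
    \prod_(i in J) fine (P (X i @^-1` B i)).

Section IndexCoding.
Variables (F : finFieldType) (m : nat).
Implicit Types (D : rel 'I_m) (Q A : {set 'I_m}) (x : 'cV[F]_m).

(* The vector x_Q of the messages with index in Q, in the order of [enum Q]. *)
Definition subvec Q x : 'cV[F]_#|Q| := \col_a x (enum_val a) 0.

Definition side_info D (i : 'I_m) : {set 'I_m} := finset (D i).

(* Problems restricted to Q are stated over ['I_#|Q|], its elements being
   relabelled through [enum_val], consistently with [subvec]. *)
Definition subdigraph D Q : rel 'I_#|Q| :=
  fun a b => D (enum_val a) (enum_val b).

Definition relabel_set A Q : {set 'I_#|Q|} :=
  finset (fun a : 'I_#|Q| => enum_val a \in A).

Definition recoverable (C : Type) (c : 'cV[F]_m -> C) D (i : 'I_m) :=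
  exists dec : C -> 'cV[F]_#|side_info D i| -> F,
    forall x, dec (c x) (subvec (side_info D i) x) = x i 0.

Definition linear_in Q l (c : 'cV[F]_m -> 'cV[F]_l) :=
  exists G : 'M[F]_(l, #|Q|), forall x, c x = G *m subvec Q x.

Definition weakly_secure d (T : measurableType d) (R : realType)
    (P : probability T R) (X : 'I_m -> T -> F) (C : finType)
    (c : 'cV[F]_m -> C) A :=
  let Xvec t : 'cV[F]_m := \col_i X i t in
  forall i : 'I_m, i \notin A ->
    cond_entropy P (X i) (fun t => (c (Xvec t), subvec A (Xvec t))) =
    entropy P (X i).

Definition index_code D l (G : 'M[F]_(l, m)) :=
  forall i : 'I_m, recoverable (fun x => G *m x) D i.

Definition secure_index_code d (T : measurableType d) (R : realType)
    (P : probability T R) (X : 'I_m -> T -> F) D A l (G : 'M[F]_(l, m)) :=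
  index_code D G /\ weakly_secure P X (fun x => G *m x) A.

(* The triple (P_1, P_2, P_{1,2}) is recorded by the sets M1 and M2 of the
   indices of the messages known to the senders. *)
Definition two_sender_code D (M1 M2 : {set 'I_m}) l1 l2
    (c1 : 'cV[F]_m -> 'cV[F]_l1) (c2 : 'cV[F]_m -> 'cV[F]_l2) :=
  [/\ linear_in M1 c1, linear_in M2 c2 &
      forall i : 'I_m, recoverable (fun x => (c1 x, c2 x)) D i].

Definition secure_two_sender_code d (T : measurableType d) (R : realType)
    (P : probability T R) (X : 'I_m -> T -> F) D (M1 M2 : {set 'I_m}) A l1 l2
    (c1 : 'cV[F]_m -> 'cV[F]_l1) (c2 : 'cV[F]_m -> 'cV[F]_l2) :=
  two_sender_code D M1 M2 c1 c2 /\
  weakly_secure P X (fun x => (c1 x, c2 x)) A.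

End IndexCoding.

Arguments subdigraph {m} D Q.

(* Main.v *)
(* The sets Pt1 and Pt2 partition the messages, so x_Pt1 and x_Pt2 are
   independent. For i in Pt1, the part of the eavesdropper's view depending on
   x_Pt2 is therefore independent of X_i jointly with the part depending on
   x_Pt1, and can be dropped from the conditional entropy; what remains is the
   view in the single-sender problem on Pt1. Symmetrically for Pt2. *)
Require Import Defs.
From HB Require Import structures.
From mathcomp Require Import all_boot all_order all_algebra.
From mathcomp Require Import all_classical all_reals all_analysis.

Set Implicit Arguments.
Unset Strict Implicit.
Unset Printing Implicit Defensive.

Import Order.TTheory GRing.Theory Num.Theory.

Local Open Scope ring_scope.

Local Open Scope classical_set_scope.

(** * Finite-valued random variables: laws, independence and conditional entropy *)

Definition independent_pair d (T : measurableType d) (R : realType)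
    (P : probability T R) (S S' : finType) (V : T -> S) (W : T -> S') :=
  forall v w, fpmf P (fun t => (V t, W t)) (v, w) = fpmf P V v * fpmf P W w.

Section Fpmf.
Variables (d : measure_display) (T : measurableType d) (R : realType).
Variable P : probability T R.

Lemma discrete_rv_pair (S S' : finType) (V : T -> S) (W : T -> S') :
  discrete_rv V -> discrete_rv W -> discrete_rv (fun t => (V t, W t)).
Proof.
move=> mV mW [v w].
rewrite (_ : _ @^-1` _ = (V @^-1` [set v]) `&` (W @^-1` [set w])).
  exact: measurableI.
by apply/seteqP; split=> t /= [-> ->].
Qed.

Lemma measurable_preimage_discrete (S : finType) (V : T -> S) (B : set S) :
  discrete_rv V -> measurable (V @^-1` B).
Proof.
move=> mV; rewrite (_ : _ @^-1` _ = \bigcup_(v in B) V @^-1` [set v]).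
  by apply: fin_bigcup_measurable => //; exact: finite_finpred.
by apply/seteqP; split=> [t Bt | t [v Bv /= ->]]; first by exists (V t).
Qed.

Lemma fpmf_eq0 (S : finType) (V : T -> S) v :
  (forall t, V t <> v) -> fpmf P V v = 0.
Proof.
move=> Vv; rewrite /fpmf (_ : _ @^-1` _ = set0) ?measure0//.
by apply/seteqP; split=> t // /Vv.
Qed.

Lemma fpmf_comp (S S' : finType) (V : T -> S) (f : S -> S') u :
  discrete_rv V ->
  fpmf P (fun t => f (V t)) u = \sum_(v | f v == u) fpmf P V v.
Proof.
move=> mV; rewrite /fpmf.
rewrite (_ : _ @^-1` _ = \bigcup_(v in [set` [pred v | f v == u]]) V @^-1` [set v]).
  rewrite measure_fin_bigcup//=; last first.
    by move=> v w _ _ [t [/= -> ->]].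
  rewrite -(bigfs _ (index_enum_uniq S)) => [|v _]; last by rewrite mem_index_enum.
  by rewrite sum_fine// => v _; exact: fin_num_measure.
apply/seteqP; split=> t /=; first by move=> /eqP fu; exists (V t).
by move=> [v /= /eqP fv ->].
Qed.

Lemma fpmf_sum1 (S : finType) (V : T -> S) :
  discrete_rv V -> \sum_v fpmf P V v = 1.
Proof.
(* Under the constant map to [tt] the whole of [S] is one fibre, so its total mass is that of the
   sure event. *)
move=> mV; have := fpmf_comp (fun=> tt) tt mV.
rewrite {1}/fpmf (_ : _ @^-1` _ = setT) ?probability_setT => [/= ->|].
  by apply: eq_bigl => v; rewrite eqxx.
by apply/seteqP; split.
Qed.

Lemma independent_pair_comp (S S' C C' : finType) (V : T -> S) (W : T -> S')
    (f : S -> C) (g : S' -> C') :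
  discrete_rv V -> discrete_rv W -> independent_pair P V W ->
  independent_pair P (fun t => f (V t)) (fun t => g (W t)).
Proof.
move=> mV mW VW u u'.
have /= -> := @fpmf_comp _ _ (fun t => (V t, W t))
  (fun vw => (f vw.1, g vw.2)) (u, u') (discrete_rv_pair mV mW).
rewrite !fpmf_comp// big_distrlr/= pair_big/=.
by apply: eq_big => [[v w]|[v w] _] //=; rewrite xpair_eqE.
Qed.

(** The factor [fpmf P W c] cancels inside the logarithm, so the term at [(b, c)] is the term at [b]
    times [fpmf P W c]; summing over [c] gives total mass 1. *)
Lemma cond_entropy_independent (S C C' : finType)
    (U : T -> S) (V : T -> C) (W : T -> C') :
  discrete_rv U -> discrete_rv V -> discrete_rv W ->
  independent_pair P (fun t => (U t, V t)) W ->
  cond_entropy P U (fun t => (V t, W t)) = cond_entropy P U V.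
Proof.
move=> mU mV mW UV_W.
have V_W : independent_pair P V W.
  exact: (independent_pair_comp snd id (discrete_rv_pair mU mV) mW UV_W).
congr (- _); apply: eq_bigr => a _.
pose h b := fpmf P (fun t => (U t, V t)) (a, b) *
  ln (fpmf P (fun t => (U t, V t)) (a, b) / fpmf P V b).
rewrite (eq_bigr (fun bc => h bc.1 * fpmf P W bc.2)) => [|[b c] _ /=].
  rewrite -(pair_bigA _ (fun b c => h b * fpmf P W c))/=.
  by apply: eq_bigr => b _; rewrite -big_distrr/= fpmf_sum1 ?mulr1.
rewrite V_W (_ : fpmf P _ _ = fpmf P (fun t => (U t, V t)) (a, b) * fpmf P W c).
  (* The cancellation in the ratio requires a nonzero mass; at mass 0 both sides vanish because of
     the factor outside the logarithm. *)
  have [->|c0] := eqVneq (fpmf P W c) 0; first by rewrite !mulr0 mul0r.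
  by rewrite -mulf_div divff// mulr1 mulrAC.
rewrite -UV_W; congr (fine (P _)).
by apply/seteqP; split=> t /= [-> -> ->].
Qed.

(** The hypothesis makes [Y'] a function of [Y] on the range of [Y]. Each value [b] taken by [Y]
    thus occurs with a single [c], and the inner sum over [c] collapses to one term. *)
Lemma cond_entropy_refine (S C C' : finType)
    (U : T -> S) (Y : T -> C) (Y' : T -> C') :
  (forall s t, Y s = Y t -> Y' s = Y' t) ->
  cond_entropy P U (fun t => (Y t, Y' t)) = cond_entropy P U Y.
Proof.
move=> YY'; congr (- _); apply: eq_bigr => a _.
pose h bc := fpmf P (fun t => (U t, (Y t, Y' t))) (a, bc) *
  ln (fpmf P (fun t => (U t, (Y t, Y' t))) (a, bc) /
      fpmf P (fun t => (Y t, Y' t)) bc).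
transitivity (\sum_b \sum_c h (b, c)).
  by rewrite pair_bigA; apply: eq_bigr => -[].
rewrite {}/h; apply: eq_bigr => b _.
(* A value [b] that [Y] never takes has no associated [c], but all its terms are 0. Otherwise a
   sample point [s] over [b] provides the surviving index [Y' s]. *)
have [[s Ysb]|noYb] := pselect (exists s, Y s = b); last first.
  rewrite fpmf_eq0 ?mul0r => [|t [_ Ytb]]; last by apply: noYb; exists t.
  apply: big1 => c _.
  by rewrite fpmf_eq0 ?mul0r => [|t [_ Ytb _]]; last by apply: noYb; exists t.
rewrite (bigD1 (Y' s))//= [X in _ + X]big1 ?addr0 => [|c cY's]; last first.
  rewrite fpmf_eq0 ?mul0r// => t [_ Ytb Y'tc].
  by case/eqP: cY's; rewrite -Y'tc; apply: YY'; rewrite Ysb.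
have -> : fpmf P (fun t => (Y t, Y' t)) (b, Y' s) = fpmf P Y b.
  congr (fine (P _)); apply/seteqP; split=> t /= [Ytb] //.
  by rewrite Ytb (YY' t s) // Ysb.
suff -> : fpmf P (fun t => (U t, (Y t, Y' t))) (a, (b, Y' s)) =
          fpmf P (fun t => (U t, Y t)) (a, b) by [].
congr (fine (P _)); apply/seteqP; split=> t /= [-> Ytb]; first by rewrite Ytb.
by rewrite Ytb (YY' t s) // Ysb.
Qed.

(* Lets the eavesdropper's view be regrouped along the partition without
   exhibiting a bijection between the two types of values. *)
Lemma cond_entropy_kernel (S C C' : finType)
    (U : T -> S) (Y : T -> C) (Y' : T -> C') :
  (forall s t, Y s = Y t <-> Y' s = Y' t) ->
  cond_entropy P U Y = cond_entropy P U Y'.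
Proof.
move=> YY'; rewrite -(cond_entropy_refine _ (fun s t => (YY' s t).1)).
rewrite -[RHS](cond_entropy_refine _ (fun s t => (YY' s t).2)).
congr (- _); apply: eq_bigr => a _.
rewrite (reindex (fun bc => (bc.2, bc.1)))/=; last first.
  by exists (fun bc => (bc.2, bc.1)) => [[]|[]].
apply: eq_bigr => -[b c] _ /=.
have -> : fpmf P (fun t => (Y t, Y' t)) (c, b) = fpmf P (fun t => (Y' t, Y t)) (b, c).
  by congr (fine (P _)); apply/seteqP; split=> t /= [-> ->].
suff -> : fpmf P (fun t => (U t, (Y t, Y' t))) (a, (c, b)) =
          fpmf P (fun t => (U t, (Y' t, Y t))) (a, (b, c)) by [].
by congr (fine (P _)); apply/seteqP; split=> t /= [-> -> ->].
Qed.

End Fpmf.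

(** * Message subvectors, decodability and linear encoders *)

Section Subvec.
Variables (F : finFieldType) (m : nat).
Implicit Types (D : rel 'I_m) (Q A M : {set 'I_m}) (x y : 'cV[F]_m).

Lemma subvec_eqP Q x y :
  subvec Q x = subvec Q y <-> (forall i, i \in Q -> x i 0 = y i 0).
Proof.
split=> [/matrixP xy i Qi|xy].
  by have := xy (enum_rank_in Qi i) 0; rewrite !mxE enum_rankK_in.
by apply/matrixP => a b; rewrite !mxE; apply/xy/enum_valP.
Qed.

(* Transports decodability between a problem and its restriction without
   relabelling the arguments of the decoder. *)
Lemma recoverableP (C : Type) (c : 'cV[F]_m -> C) D i :
  recoverable c D i <->
  (forall x y, c x = c y -> (forall j, D i j -> x j 0 = y j 0) ->
    x i 0 = y i 0).
Proof.
split=> [[dec decE] x y cxy xy|cD].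
  rewrite -!decE cxy; congr dec; apply/subvec_eqP => j.
  by rewrite inE => /xy.
(* The decoder picks any message vector consistent with the codeword and the side information and
   reads off its coordinate [i]. The default 0 is never reached on actual inputs, since [x] itself
   is consistent. *)
exists (fun c0 k => if pselect (exists x, c x = c0 /\ subvec _ x = k) is left e
  then projT1 (cid e) i 0 else 0) => x.
case: pselect => [e|[]]; last by exists x.
case: cid => y /= [cy /subvec_eqP yx]; apply: cD => // j Dij.
by apply: yx; rewrite inE.
Qed.

Lemma linear_in_subset Q M l (G : 'M[F]_(l, #|Q|)) :
  Q \subset M -> linear_in M (fun x => G *m subvec Q x).
Proof.
(* [E] is the 0-1 selection matrix extracting x_Q from x_M: each row has exactly one 1, because [Q]
   is contained in [M]. *)
move=> QM; pose E : 'M[F]_(#|Q|, #|M|) :=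
  \matrix_(a, b) (enum_val a == enum_val b)%:R.
exists (G *m E) => x; rewrite -mulmxA; congr (G *m _).
apply/matrixP => a o; rewrite !mxE.
have Ma : enum_val a \in M by apply: (fintype.subsetP QM); exact: enum_valP.
rewrite (bigD1 (enum_rank_in Ma (enum_val a)))//= !mxE enum_rankK_in//.
rewrite eqxx mul1r big1 ?addr0// => b bE; rewrite !mxE.
case: eqP => [ab|_]; last by rewrite /= mul0r.
by case/eqP: bE; apply: enum_val_inj; rewrite enum_rankK_in.
Qed.

End Subvec.

(** * Passing to the problem induced by a set of messages *)

Section Restriction.
Variables (F : finFieldType) (m : nat).
Implicit Types (D : rel 'I_m) (Q A : {set 'I_m}) (x y : 'cV[F]_m).

(** In the full problem a receiver has at least the side information of the restricted one, and [c']
    determines the restricted codeword; hence two message vectors that it confuses would already be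
    confused in the restricted problem. *)
Lemma recoverable_subdigraph D Q (C C' : Type) (c : 'cV[F]_#|Q| -> C)
    (c' : 'cV[F]_m -> C') (a : 'I_#|Q|) :
  (forall x y, c' x = c' y -> c (subvec Q x) = c (subvec Q y)) ->
  recoverable c (subdigraph D Q) a -> recoverable c' D (enum_val a).
Proof.
move=> c'c /recoverableP cD; apply/recoverableP => x y /c'c cxy xy.
have := cD _ _ cxy; rewrite !mxE; apply => b Dab.
by rewrite !mxE; apply: xy.
Qed.

Lemma subvec_relabel_eqP A Q x y :
  subvec (relabel_set A Q) (subvec Q x) = subvec (relabel_set A Q) (subvec Q y)
  <-> (forall i, i \in Q -> i \in A -> x i 0 = y i 0).
Proof.
split=> [/subvec_eqP xy i Qi Ai|xy].
  have := xy (enum_rank_in Qi i); rewrite inE !mxE enum_rankK_in//.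
  exact.
apply/subvec_eqP => a; rewrite inE !mxE; apply: xy; exact: enum_valP.
Qed.

End Restriction.

(** * Independence of subvectors and the view of the eavesdropper *)

Section Independence.
Variables (F : finFieldType) (m : nat).
Variables (d : measure_display) (T : measurableType d) (R : realType).
Variables (P : probability T R) (X : 'I_m -> T -> F).
Hypothesis X_rv : forall i, discrete_rv (X i).
Hypothesis X_indep : mutually_independent P X.
Implicit Types (Q A : {set 'I_m}).

Let Xvec t : 'cV[F]_m := \col_i X i t.

(** Defined at every index, as [mutually_independent] expects: a singleton for [i] in [Q], and all
    of [F] outside [Q], where the condition is vacuous. *)
Let cylinder Q (v : 'cV[F]_#|Q|) (i : 'I_m) : set F :=
  [set y | forall a : 'I_#|Q|, enum_val a = i -> y = v a 0].

Lemma subvec_preimage Q (v : 'cV[F]_#|Q|) :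
  (fun t => subvec Q (Xvec t)) @^-1` [set v] =
  \bigcap_(i in [set` Q]) (X i @^-1` cylinder v i).
Proof.
apply/seteqP; split=> t /=.
  by move=> <- i Qi a <- /=; rewrite !mxE.
move=> Xv; apply/matrixP => a o; rewrite !mxE ord1.
by apply: (Xv (enum_val a)) => //=; exact: enum_valP.
Qed.

Lemma discrete_rv_subvec Q : discrete_rv (fun t => subvec Q (Xvec t)).
Proof.
move=> v; rewrite subvec_preimage; apply: fin_bigcap_measurable => [|i _].
  exact: finite_finpred.
exact: measurable_preimage_discrete.
Qed.

(** The joint event is again an intersection of coordinate events, now over the union of [Q1] and
    [Q2], and a product over a disjoint union splits. *)
Lemma independent_subvec Q1 Q2 : [disjoint Q1 & Q2]%B ->
  independent_pair P (fun t => subvec Q1 (Xvec t))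
                     (fun t => subvec Q2 (Xvec t)).
Proof.
move=> Q12 v w; rewrite /fpmf !subvec_preimage !X_indep.
(* Disjointness lets the two families of coordinate constraints be glued into one. *)
pose B i := if i \in Q1 then cylinder v i else cylinder w i.
have BQ1 i : i \in Q1 -> B i = cylinder v i by rewrite /B => ->.
have BQ2 i : i \in Q2 -> B i = cylinder w i.
  by rewrite /B => Qi; rewrite (disjointFl Q12 Qi).
rewrite (_ : _ @^-1` _ = \bigcap_(i in [set` Q1 :|: Q2]) (X i @^-1` B i)).
  rewrite X_indep (eq_bigl (mem [predU Q1 & Q2])) => [|i]; last by rewrite !inE.
  rewrite bigU//=.
  by congr (_ * _); apply: eq_bigr => i Qi; [rewrite BQ1|rewrite BQ2].
transitivity ((fun t => subvec Q1 (Xvec t)) @^-1` [set v] `&`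
              (fun t => subvec Q2 (Xvec t)) @^-1` [set w]).
  by apply/seteqP; split=> t /= [-> ->].
rewrite !subvec_preimage; apply/seteqP; split=> t /=.
  move=> [Xv Xw] i /=; rewrite inE => /orP[] Qi.
    by rewrite BQ1//; exact: Xv.
  by rewrite BQ2//; exact: Xw.
move=> XB; split=> i /= Qi.
  by rewrite -BQ1//; apply: XB; rewrite /= inE Qi.
by rewrite -BQ2//; apply: XB; rewrite /= inE Qi orbT.
Qed.

(** The view [Y] enters only through its kernel, so the same statement serves both halves of the
    partition, whatever the order of the two codewords. *)
Lemma cond_entropy_two_parts Q1 Q2 A (C1 C2 C : finType)
    (c1 : 'cV[F]_#|Q1| -> C1) (c2 : 'cV[F]_#|Q2| -> C2) (Y : T -> C) i :
  [disjoint Q1 & Q2]%B -> Q1 :|: Q2 = [set: 'I_m]%SET ->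
  weakly_secure P (fun a => X (enum_val a)) c1 (relabel_set A Q1) ->
  (forall s t, Y s = Y t <->
    [/\ c1 (subvec Q1 (Xvec s)) = c1 (subvec Q1 (Xvec t)),
        c2 (subvec Q2 (Xvec s)) = c2 (subvec Q2 (Xvec t)) &
        subvec A (Xvec s) = subvec A (Xvec t)]) ->
  i \in Q1 -> i \notin A ->
  cond_entropy P (X i) Y = entropy P (X i).
Proof.
move=> Q12 Q12T secure YE Qi nAi.
have := secure (enum_rank_in Qi i).
rewrite inE enum_rankK_in// => /(_ nAi) <-.
pose f1 v := (c1 v, subvec (relabel_set A Q1) v).
pose f2 v := (c2 v, subvec (relabel_set A Q2) v).
have m1 := @discrete_rv_subvec Q1; have m2 := @discrete_rv_subvec Q2.
have mcomp Q (S : finType) (f : 'cV[F]_#|Q| -> S) :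
  discrete_rv (fun t => f (subvec Q (Xvec t))).
  by move=> u; apply: (measurable_preimage_discrete (f @^-1` [set u])
    (@discrete_rv_subvec Q)).
(* The view is regrouped into a function of x_Q1 and a function of x_Q2. The kernels agree since
   [Q1] and [Q2] cover all indices, so that x_A is determined by its parts in [Q1] and in [Q2]. *)
rewrite (@cond_entropy_kernel _ _ _ _ _ _ _ _ _
  (fun t => (f1 (subvec Q1 (Xvec t)), f2 (subvec Q2 (Xvec t))))).
  rewrite cond_entropy_independent; [|exact: X_rv|exact: mcomp|exact: mcomp|].
    congr cond_entropy; apply/funext => t.
    by rewrite /f1; congr (c1 _, subvec _ _); apply/matrixP => a o; rewrite !mxE.
  (* [X i] is a coordinate of x_Q1, so [X i] paired with the first part of the view is still a
     function of x_Q1. *)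
  have := independent_pair_comp
    (fun v : 'cV[F]_#|Q1| => (v (enum_rank_in Qi i) 0, f1 v)) f2
    m1 m2 (independent_subvec Q12).
  congr (independent_pair P _ _); apply/funext => t.
  by rewrite !mxE enum_rankK_in.
move=> s t; rewrite YE /f1 /f2; split.
  move=> [-> -> /subvec_eqP st]; congr (_, _, (_, _));
    by apply/subvec_relabel_eqP => j _; exact: st.
move=> [-> /subvec_relabel_eqP st1 -> /subvec_relabel_eqP st2]; split=> //.
apply/subvec_eqP => j Aj; have : j \in Q1 :|: Q2 by rewrite Q12T inE.
by rewrite inE => /orP[Qj|Qj]; [exact: st1|exact: st2].
Qed.

End Independence.

(* The combined code: linearity, decodability and security *)
Local Close Scope classical_set_scope.

Theorem theorem1 (F : finFieldType) (m : nat)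
  (d : measure_display) (T : measurableType d) (R : realType)
  (P : probability T R) (X : 'I_m -> T -> F)
  (X_rv : forall i : 'I_m, discrete_rv (X i))
  (X_unif : forall i : 'I_m, uniform_rv P (X i))
  (X_indep : mutually_independent P X)
  (D : rel 'I_m) (D_irr : irreflexive D)
  (M1 M2 : {set 'I_m}) (M_cover : M1 :|: M2 = [set: 'I_m]%SET)
  (A : {set 'I_m}) (A_proper : A \proper [set: 'I_m]%SET)
  (S1 S2 : {set 'I_m}) (S_cover : S1 :|: S2 = M1 :&: M2)
  (S_disj : [disjoint S1 & S2]) :
  let P1 := M1 :\: M2 in
  let P2 := M2 :\: M1 in
  let Pt1 := S1 :|: P1 in
  let Pt2 := S2 :|: P2 in
  forall (l1 l2 : nat) (G1 : 'M[F]_(l1, #|Pt1|)) (G2 : 'M[F]_(l2, #|Pt2|)),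
    secure_index_code P (fun a => X (enum_val a))
      (subdigraph D Pt1) (relabel_set A Pt1) G1 ->
    secure_index_code P (fun a => X (enum_val a))
      (subdigraph D Pt2) (relabel_set A Pt2) G2 ->
    secure_two_sender_code P X D M1 M2 A
      (fun x => G1 *m subvec Pt1 x) (fun x => G2 *m subvec Pt2 x).
Proof.
move=> P1 P2 Pt1 Pt2 l1 l2 G1 G2 [code1 secure1] [code2 secure2].
have S1M : S1 \subset M1 :&: M2 by rewrite -S_cover finset.subsetUl.
have S2M : S2 \subset M1 :&: M2 by rewrite -S_cover finset.subsetUr.
(* A message known to one sender only lies in [P1] or [P2], a shared one in [S1] or [S2]; what
   remains is a truth table on four memberships. *)
have Pt_cover : Pt1 :|: Pt2 = [set: 'I_m]%SET.
  apply/finset.setP => i; have := finset.in_setT i; rewrite -M_cover.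
  have := finset.in_setU i S1 S2; rewrite S_cover !inE.
  by case: (i \in M1); case: (i \in M2); case: (i \in S1); case: (i \in S2).
have Pt_disj : [disjoint Pt1 & Pt2].
  rewrite -finset.setI_eq0; apply/eqP/finset.setP => i; rewrite !inE.
  have := fintype.subsetP S1M i; have := fintype.subsetP S2M i; rewrite !inE.
  have := @disjointFr _ _ _ i S_disj.
  case: (i \in M1); case: (i \in M2); case: (i \in S1); case: (i \in S2) => //=;
    by [move/(_ isT) | move=> _ /(_ isT) | move=> _ _ /(_ isT)].
have Pt_or i : i \in Pt1 \/ i \in Pt2 by apply/orP; rewrite -finset.in_setU Pt_cover inE.
split; first split.
- apply: linear_in_subset; apply/fintype.subsetP => i; rewrite !inE.
  by case/orP => [/(fintype.subsetP S1M)|]; rewrite ?inE => /andP[].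
- apply: linear_in_subset; apply/fintype.subsetP => i; rewrite !inE.
  by case/orP => [/(fintype.subsetP S2M)|]; rewrite ?inE => /andP[].
- move=> i; case: (Pt_or i) => Pti; rewrite -(enum_rankK_in Pti Pti).
    by apply: recoverable_subdigraph (code1 _) => x y [].
  by apply: recoverable_subdigraph (code2 _) => x y [].
move=> i nAi; case: (Pt_or i) => Pti.
  apply: (cond_entropy_two_parts (c2 := fun v => G2 *m v) X_rv X_indep Pt_disj
    Pt_cover secure1) Pti nAi.
  by move=> s t; split=> [[]|[-> -> ->]].
(* The second half follows by exchanging the roles of the two parts. *)
rewrite disjoint_sym in Pt_disj; rewrite finset.setUC in Pt_cover.
apply: (cond_entropy_two_parts (c2 := fun v => G1 *m v) X_rv X_indep Pt_disj
  Pt_cover secure2) Pti nAi.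
by move=> s t; split=> [[]|[-> -> ->]].
Qed.
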